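(* Let $X$ be a countable regular $T_1$ space. The following are equivalent: (i) $X$ is $SS^+$. (ii) $X$ is $\sigma$-compactlike. (iii) $X$ has a weak base which is an $F_\sigma$ subset of $2^X$. (iv) $X$ has a weak $\pi$-base which is an $F_\sigma$ subset of $2^X$. (v) The collection $\mathfrak D(X)$ of all dense subsets of $X$ is a $G_\delta$ subset of $2^X$.
   Context: $2^X$ is the power set of $X$, identified via characteristic functions with the product of copies of the discrete space $\{0,1\}$, with the product topology. The game $G_{fin}$ on $X$: in round $n\in\mathbb N$, player I picks a dense subset $D_n$ of $X$ and then player II picks a finite set $a_n\subseteq D_n$. Player II wins the run if $\bigcup_n a_n$ is dense in $X$; otherwise player I wins. $X$ is $SS^+$ if player II has a winning strategy for $G_{fin}$. A collection $\mathcal C$ of subsets of $X$ is compactlike if for every dense $D\subseteq X$ there is a finite $a\subseteq D$ such that $a\cap V\neq\emptyset$ for all $V\in\mathcal C$. $X$ is $\sigma$-compactlike if there is a sequence $(\mathcal C_n)_n$ of compactlike families of open subsets of $X$ such that the collection of all non-empty open subsets of $X$ equals $\bigcup_n\mathcal C_n$. A collection $\mathcal P$ of (not necessarily open) subsets of $X$ is a weak base if every set in $\mathcal P$ has non-empty interior and for every non-empty open set $W$ and every $x\in W$ there is $V\in\mathcal P$ such that $x\in\mathrm{int}(V)\subseteq V\subseteq W$. It is a weak $\pi$-base if every set in $\mathcal P$ has non-empty interior and for every non-empty open set $W$ there is $V\in\mathcal P$ with $V\subseteq W$. *)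

(* Defs.v *)
From mathcomp Require Import all_boot.
From mathcomp Require Import all_classical.
From mathcomp Require Import topology borel_hierarchy.

Set Implicit Arguments.
Unset Strict Implicit.
Unset Printing Implicit Defensive.

Local Open Scope classical_set_scope.

Section Definitions.
Context {X : topologicalType}.
Implicit Types (C P : set (set X)) (A : set X).

(* The space 2^X; [bool] carries the discrete topology. *)
Definition power_space : topologicalType := prod_topology (fun _ : X => bool).

Definition char_fun A : power_space := fun x => `[< A x >].

(* Topological properties of a family of subsets of X, as a subset of 2^X. *)
Definition Fsigma_family P := Fsigma (char_fun @` P).

Definition Gdelta_family P := Gdelta (char_fun @` P).

(* A strategy for player II in G_fin maps the sequence [:: D_0; ...; D_n] of
   the moves made so far by player I to the answer a_n; player II's own earlier
   moves are determined by the strategy and by proper prefixes of this list. *)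
Definition strategy := seq (set X) -> set X.

Definition answer (s : strategy) (D : nat -> set X) (n : nat) : set X :=
  s (mkseq D n.+1).

Definition winning_strategy (s : strategy) :=
  forall D : nat -> set X, (forall n, dense (D n)) ->
    (forall n, finite_set (answer s D n) /\ answer s D n `<=` D n) /\
    dense (\bigcup_n answer s D n).

Definition SS_plus := exists s : strategy, winning_strategy s.

Definition compactlike C :=
  forall D : set X, dense D ->
    exists a : set X, [/\ finite_set a, a `<=` D &
      forall V, C V -> a `&` V !=set0].

Definition sigma_compactlike :=
  exists C : nat -> set (set X),
    (forall n, compactlike (C n) /\ C n `<=` open) /\
    [set U | open U /\ U !=set0] = \bigcup_n C n.

Definition weak_base P :=
  (forall V, P V -> interior V !=set0) /\
  (forall W x, open W -> W x ->
     exists V, [/\ P V, interior V x & V `<=` W]).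

Definition weak_pi_base P :=
  (forall V, P V -> interior V !=set0) /\
  (forall W, open W -> W !=set0 -> exists V, P V /\ V `<=` W).

End Definitions.

Arguments power_space : clear implicits.
Arguments strategy : clear implicits.
Arguments SS_plus : clear implicits.
Arguments sigma_compactlike : clear implicits.

(* Main.v *)
Require Import Defs.
From HB Require Import structures.
From mathcomp Require Import all_boot finmap.
From mathcomp Require Import all_classical.
From mathcomp Require Import topology borel_hierarchy.

Set Implicit Arguments.
Unset Strict Implicit.
Unset Printing Implicit Defensive.

Local Open Scope classical_set_scope.

(* Everything but the first implication rests on the compactness of 2^X.
   - From a winning strategy: for a position p let C_p be the open sets met by
     every answer at p. Since X has only countably many finite subsets, one
     move per possible answer yields a countable tree of positions; an open
     set outside all the C_p of the tree would be avoided along a branch.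
   - The condition defining compactlikeness is closed in 2^X, so the closures
     of compactlike families are again compactlike, and their members have
     non-empty interior because no dense set avoids them.
   - D is dense iff it meets every member of a weak pi-base, and meeting every
     member of a compact subset of 2^X is an open condition on D.
   - If the dense sets are the intersection of open sets U_n, then all supersets
     of a dense D lie in U_n, hence by compactness so do all supersets of some
     finite part of D; player II answers with that part in round n. *)

(** * Clopen conditions and compactness in $2^X$ *)

Section PowerSpace.
Context {X : topologicalType}.
Implicit Types (A D a : set X) (K : set (power_space X)).

Lemma char_funE A x : char_fun A x = true <-> A x.
Proof. by split=> [/asboolP|/asboolP]. Qed.

Lemma char_fun_inj : injective (@char_fun X).
Proof.
move=> A B eAB; apply/seteqP; split=> x /char_funE Ax; apply/char_funE.
  by rewrite -eAB.
by rewrite eAB.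
Qed.

Lemma char_funK (f : power_space X) : char_fun [set x | f x] = f.
Proof. by apply/funext => x; rewrite /char_fun asboolb. Qed.

Lemma image_char_fun K : char_fun @` [set A | K (char_fun A)] = K.
Proof.
apply/seteqP; split=> [_ [A KA <-] //|f Kf].
by exists [set x | f x]; rewrite /= char_funK.
Qed.

Lemma closed_eval x (b : bool) : closed [set f : power_space X | f x = b].
Proof.
apply: (@preimage_closed _ _ (fun f : power_space X => f x) [set b]).
  by move=> f _; exact: (@proj_continuous X (fun _ => bool)).
exact: discrete_closed.
Qed.

Lemma closed_exists_eval a (b : bool) : finite_set a ->
  closed [set f : power_space X | exists2 x, a x & f x = b].
Proof.
move=> fina.
rewrite (_ : mkset _ = \bigcup_(x in a) [set f : power_space X | f x = b]).
  by apply: closed_bigcup => // x _; exact: closed_eval.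
by apply/seteqP; split=> f [x]; exists x.
Qed.

Lemma open_forall_eval a (b : bool) : finite_set a ->
  open [set f : power_space X | forall x, a x -> f x = b].
Proof.
move=> fina.
rewrite (_ : mkset _ = ~` [set f : power_space X | exists2 x, a x & f x = ~~ b]).
  by apply: closed_openC; exact: closed_exists_eval.
apply/seteqP; split=> f fa.
  by move=> [x ax]; rewrite fa//; case: b {fa}.
move=> x ax; have [//|/eqP fxb] := eqVneq (f x) b; exfalso; apply: fa.
by exists x => //; case: b (f x) fxb => -[].
Qed.

(** Finitely many of the clopen sets [f x = b] with [x] in [D] cover the compact set [K]. For
    [b = true] the members of [K] meet [D]; for [b = false] they fail to contain it. *)
Lemma compact_hit K D (b : bool) : closed K ->
    (forall f, K f -> exists2 x, D x & f x = b) ->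
  exists a : set X, [/\ finite_set a, a `<=` D &
    forall f, K f -> exists2 x, a x & f x = b].
Proof.
move=> closedK KD.
have compactT : compact [set: power_space X].
  have := @tychonoff X (fun _ => bool) (fun _ => [set: bool]) (fun=> bool_compact).
  by congr compact; apply/seteqP; split.
(* [compact_cover] is only available for pointed spaces. *)
pose pT : ptopologicalType :=
  HB.pack (power_space X) (isPointed.Build (power_space X) (fun=> false)).
have : @cover_compact pT K.
  by rewrite -(@compact_cover pT); apply: (subclosed_compact closedK compactT).
move=> /(_ X D (fun x => [set f : power_space X | f x = b])) [].
- move=> x _.
  have := @open_forall_eval [set x] b (finite_set1 x).
  by congr open; apply/seteqP; split=> f /=; [exact|move=> fx _ ->].
- by move=> f /KD[x Dx fx]; exists x.
move=> a aD Ka; exists [set` a]; split.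
- exact: finite_fset.
- by move=> x /= /aD; rewrite inE.
- by move=> f /Ka[x ax fx]; exists x.
Qed.

End PowerSpace.

Section Implications.
Context {X : topologicalType}.

(** * A countable tree of positions of the game *)

Section PositionTree.
Variables (s : strategy X) (code : X -> nat).
Hypothesis winning_s : winning_strategy s.
Hypothesis code_inj : {in [set: X] &, injective code}.

(** Coding finite sets by lists of numbers makes the countable type [seq (seq nat)] index the
    tree. *)
Definition decode (l : seq nat) : set X := [set x | code x \in l].

(** The default [setT] is dense, so the move is legal even if no move is answered by [decode l]. *)
Definition move_answered (p : seq (set X)) (l : seq nat) : set X :=
  xget setT [set D | dense D /\ s (rcons p D) = decode l].

(* The most recent answer comes first in [t]. *)
Fixpoint position (t : seq (seq nat)) : seq (set X) :=
  if t is l :: t' then rcons (position t') (move_answered (position t') l)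
  else [::].

Definition forced_open (p : seq (set X)) : set (set X) :=
  [set V | [/\ open V, V !=set0 &
    forall D, dense D -> s (rcons p D) `&` V !=set0]].

Lemma dense_setT : dense [set: X].
Proof. by move=> O [x Ox] _; exists x. Qed.

Lemma dense_move_answered p l : dense (move_answered p l).
Proof.
rewrite /move_answered; case: xgetP => [D -> []//|_]; exact: dense_setT.
Qed.

Lemma dense_position t i : dense (nth setT (position t) i).
Proof.
elim: t i => [|l t IH] i /=; first by rewrite nth_nil; exact: dense_setT.
rewrite nth_rcons; case: ifP => // _; case: ifP => _.
  exact: dense_move_answered.
exact: dense_setT.
Qed.

Lemma answer_position t D : dense D ->
  finite_set (s (rcons (position t) D)) /\ s (rcons (position t) D) `<=` D.
Proof.
move=> dD; set p := position t.
(* The position is completed to an infinite run in which player I plays all of $X$ after [D]. *)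
have dE i : dense (nth setT (rcons p D) i).
  rewrite nth_rcons; case: ifP => _; first exact: dense_position.
  by case: ifP => // _; exact: dense_setT.
have [/(_ (size p))] := winning_s dE.
rewrite /answer -(size_rcons p D) mkseq_nth nth_rcons ltnn eqxx.
by move=> [? ?] _; split.
Qed.

Lemma move_answeredE t D : dense D ->
  exists l, s (rcons (position t) (move_answered (position t) l)) =
            s (rcons (position t) D).
Proof.
move=> dD; have [/finite_seqP[r rE] _] := answer_position t dD.
exists (map code r); rewrite /move_answered.
have sE : s (rcons (position t) D) = decode (map code r).
  rewrite rE; apply/seteqP; split=> x /=; first exact: map_f.
  by move=> /mapP[y yr /code_inj ->//]; rewrite inE.
case: xgetP => [E _ [_ ->]//|/(_ D)]; by case; split.
Qed.

Lemma compactlike_forced_open t : compactlike (forced_open (position t)).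
Proof.
move=> D dD; have [fs sD] := answer_position t dD.
by exists (s (rcons (position t) D)); split => // V [_ _]; exact.
Qed.

Lemma forced_open_cover V : open V -> V !=set0 ->
  exists t, forced_open (position t) V.
Proof.
move=> oV V0; apply: contrapT => notforced.
have next t : exists l : seq nat,
    s (position (l :: t)) `&` V = set0.
  apply: contrapT => nl; apply: notforced; exists t; split => // D dD.
  have [l lE] := move_answeredE t dD; apply/set0P/eqP => sD0.
  by apply: nl; exists l; rewrite /= lE.
have [g gP] := choice next.
(* Always passing to a child whose answer misses [V] yields a full run; [E n] is the move of player
   I in round [n]. *)
pose branch := fix branch n := if n is m.+1 then g (branch m) :: branch m else [::].
pose E n := move_answered (position (branch n)) (g (branch n)).
have branchE n : position (branch n) = mkseq E n.
  by elim: n => [//|n IH]; rewrite mkseqS -IH.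
have [_ /(_ V V0 oV)] := winning_s (fun n => dense_move_answered _ _ : dense (E n)).
move=> [x [Vx [n _]]]; rewrite /answer -branchE => sx.
by have : set0 x by rewrite -(gP (branch n)).
Qed.

End PositionTree.

(** * The cycle of implications *)

Lemma SS_plus_sigma_compactlike :
  countable [set: X] -> SS_plus X -> sigma_compactlike X.
Proof.
move=> /pcard_injP[code code_inj] [s win].
(* Numbers coding no node go to the root, whose family is compactlike too. *)
pose pos n := position s code (odflt [::] (choice.unpickle n)).
exists (fun n => forced_open s (pos n)); split.
  by move=> n; split; [exact: compactlike_forced_open|move=> V []].
apply/seteqP; split=> [V [oV V0]|V [n _ [//]]].
have [t tV] := forced_open_cover win code_inj oV V0.
by exists (choice.pickle t) => //; rewrite /pos choice.pickleK.
Qed.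

Lemma sigma_compactlike_weak_base : sigma_compactlike X ->
  exists P : set (set X), weak_base P /\ Fsigma_family P.
Proof.
move=> [C [compC openE]].
pose K n := closure (char_fun @` C n).
exists [set A | (\bigcup_n K n) (char_fun A)]; split; last first.
  by rewrite /Fsigma_family image_char_fun; exists K => // n; exact: closed_closure.
split=> [V [n _ KV]|W x oW Wx]; last first.
  have [n _ CW] : (\bigcup_n C n) W by rewrite -openE; split => //; exists x.
  exists W; split => //; last exact: open_nbhs_nbhs.
  by exists n => //; apply: subset_closure; exists W.
apply: contrapT => V0.
have dVC : dense (~` V).
  move=> O [x Ox] oO; apply: contrapT => OV; apply: V0; exists x.
  apply: filterS (open_nbhs_nbhs (conj oO Ox)) => y Oy.
  by apply: contrapT => nVy; apply: OV; exists y.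
have [a [fina aV aC]] := (compC n).1 _ dVC.
(* Meeting the finite set [a] is a closed condition, so it passes from [C n] to its closure. *)
have [x ax /char_funE Vx] :
    [set f : power_space X | exists2 x, a x & f x = true] (char_fun V).
  have /closure_id -> := closed_exists_eval (b := true) fina.
  apply: closureS KV => _ [U /aC[x [ax Ux]] <-].
  by exists x => //; exact/char_funE.
exact: aV ax Vx.
Qed.

Lemma weak_base_weak_pi_base (P : set (set X)) : weak_base P -> weak_pi_base P.
Proof.
move=> [PI PW]; split=> // W oW [x Wx].
by have [V [PV _ VW]] := PW W x oW Wx; exists V.
Qed.

Lemma weak_pi_base_denseE (P : set (set X)) D : weak_pi_base P ->
  dense D <-> forall V, P V -> exists2 x, D x & V x.
Proof.
move=> [PI PW]; split=> [dD V /PI V0|DP O O0 oO].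
  have [x [/interior_subset Vx Dx]] := dD _ V0 (@open_interior _ V).
  by exists x.
have [V [PV VO]] := PW O oO O0; have [x Dx /VO Ox] := DP V PV.
by exists x.
Qed.

Lemma weak_pi_base_Gdelta_dense (P : set (set X)) :
  weak_pi_base P -> Fsigma_family P -> Gdelta_family [set D : set X | dense D].
Proof.
move=> piP [F closedF PE].
pose U n := [set g : power_space X |
  forall f, F n f -> exists2 x, [set x | g x] x & f x = true].
exists U => [n|].
  rewrite openE => g gU.
  (* Every [h] that is true on this finite [a] still meets all of [F n], which gives a neighbourhood
     of [g] inside [U n]. *)
  have [a [fina ag aF]] := compact_hit (closedF n) gU.
  have gnear : nbhs g [set h : power_space X | forall x, a x -> h x = true].
    by apply: open_nbhs_nbhs; split; [exact: open_forall_eval|move=> x /ag].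
  apply: filterS gnear => h ha f /aF[x ax fx].
  by exists x => //; exact: ha.
rewrite -[RHS]image_char_fun; congr image; apply/seteqP; split=> D /=.
  move=> /(weak_pi_base_denseE _ piP) DP n _ f Ff.
  have : (char_fun @` P) f by rewrite PE; exists n.
  by move=> [V /DP[x Dx Vx] <-]; exists x; exact/char_funE.
move=> DU; apply/(weak_pi_base_denseE _ piP) => V PV.
have [n _ FV] : (\bigcup_n F n) (char_fun V) by rewrite -PE; exists V.
have [x /char_funE Dx /char_funE Vx] := DU n I _ FV.
by exists x.
Qed.

Lemma denseS (A B : set X) : A `<=` B -> dense A -> dense B.
Proof. by move=> AB dA O O0 oO; have [x [Ox /AB]] := dA O O0 oO; exists x. Qed.

Lemma Gdelta_dense_SS_plus :
  Gdelta_family [set D : set X | dense D] -> SS_plus X.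
Proof.
move=> [U openU UE].
have denseE D : dense D <-> forall n, U n (char_fun D).
  have -> : (forall n, U n (char_fun D)) <-> (\bigcap_n U n) (char_fun D).
    by split=> [UD n _|UD n]; exact: UD.
  rewrite -UE; split=> [dD|[E dE /char_fun_inj <-//]]; by exists D.
pose good n D := [set a : set X | [/\ finite_set a, a `<=` D &
  forall B, a `<=` B -> U n (char_fun B)]].
have goodP n D : dense D -> exists a, good n D a.
  move=> dD.
  (* Points outside [U n] are not dense sets, so each takes the value false somewhere on [D]. *)
  have [|f nUf|a [fina aD aU]] := @compact_hit X (~` U n) D false.
  - exact: open_closedC.
  - apply: contrapT => Df; apply: nUf; rewrite -(char_funK f).
    apply: (denseE _).1; apply: denseS dD => x Dx /=.
    by apply: contrapT => /negP/negbTE fx; apply: Df; exists x.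
  exists a; split=> // B aB; apply: contrapT => /aU[x /aB /char_funE ->].
  by [].
(* The list [p] includes the current move, so the round number is its length minus one. *)
exists (fun p => xget set0 (good (size p).-1 (last setT p))) => D dD.
have ansP n : good n (D n)
    (answer (fun p => xget set0 (good (size p).-1 (last setT p))) D n).
  rewrite /answer size_mkseq mkseqS last_rcons /=.
  exact: (xgetPex set0 (goodP n (D n) (dD n))).
split=> [n|]; first by have [] := ansP n.
apply/denseE => n; have [_ _] := ansP n; apply; exact: bigcup_sup.
Qed.

End Implications.

Theorem theorem4p7 (X : topologicalType) (countX : countable [set: X])
    (regX : @regular_space X) (T1X : accessible_space X) :
  [<-> SS_plus X;
       sigma_compactlike X;
       exists P : set (set X), weak_base P /\ Fsigma_family P;
       exists P : set (set X), weak_pi_base P /\ Fsigma_family P;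
       Gdelta_family [set D : set X | dense D]].
Proof.
tfae.
- exact: SS_plus_sigma_compactlike.
- exact: sigma_compactlike_weak_base.
- by move=> [P [/weak_base_weak_pi_base piP FP]]; exists P.
- by move=> [P [piP FP]]; exact: weak_pi_base_Gdelta_dense piP FP.
- exact: Gdelta_dense_SS_plus.
Qed.
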